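(* Let $1\le p<\infty$ and let $Y$ be an $L$-quasiconvex metric space with a complete Borel measure $\nu$ such that $0<\nu(B)<\infty$ for all balls. Assume that $\nu$ is doubling and supports a $p$-Poincaré inequality, both for balls of radii at most $R_0$. Let $R_1>0$. Then $\nu$ supports a $p$-Poincaré inequality with dilation $L$ for balls of radii at most $R_1$.
   Context: $L$-quasiconvex: any $x,y$ are joined by a curve of length $\le L\,d(x,y)$. Doubling for balls of radii at most $R_0$: $0<\nu(B(x,2r))\le C_d\nu(B(x,r))<\infty$ for all $x$ and $0<r\le R_0$. Upper gradient of $u$: Borel $g\ge0$ with $|u(\gamma(0))-u(\gamma(l_\gamma))|\le\int_\gamma g\,ds$ for all arc-length parametrized rectifiable curves. $p$-Poincaré inequality with dilation $\lambda\ge1$ for balls of radii at most $R$: there is $C$ such that for all balls $B$ of radius $\le R$, bounded measurable $u$ and upper gradients $g$ of $u$, $\frac1{\nu(B)}\int_B|u-u_B|d\nu\le C\operatorname{diam}(B)(\frac1{\nu(\lambda B)}\int_{\lambda B}g^pd\nu)^{1/p}$, $u_B$ the $\nu$-average of $u$ over $B$. *)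

(* Defs.v *)
From HB Require Import structures.
From mathcomp Require Import all_boot all_order all_algebra.
From mathcomp Require Import all_classical all_reals all_analysis measurable_realfun.
Set Implicit Arguments. Unset Strict Implicit. Unset Printing Implicit Defensive.
Import Order.TTheory GRing.Theory Num.Theory.
Import numFieldNormedType.Exports.
Local Open Scope classical_set_scope.
Local Open Scope ring_scope.

Section MetricMeasure.
Context {R : realType} {T : Type}.
Variable dist : T -> T -> R.

Definition is_metric : Prop :=
  [/\ forall x y, 0 <= dist x y,
      forall x y, dist x y = 0 <-> x = y,
      forall x y, dist x y = dist y x &
      forall x y z, dist x z <= dist x y + dist y z].

Definition mball (x : T) (r : R) : set T := [set y | dist x y < r].

Definition mopen (A : set T) : Prop :=
  forall x, A x -> exists2 r : R, 0 < r & mball x r `<=` A.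

Definition mborel : set (set T) := smallest (sigma_algebra setT) mopen.

Definition mdiam (A : set T) : \bar R :=
  ereal_sup [set z | exists x y, A x /\ A y /\ z = (dist x y)%:E].

Definition mcontinuous_on (gamma : R -> T) (a b : R) : Prop :=
  forall s, a <= s <= b -> forall e : R, 0 < e -> exists2 del : R, 0 < del &
    forall t, a <= t <= b -> `|t - s| < del -> dist (gamma s) (gamma t) < e.

Definition clength (gamma : R -> T) (a b : R) : \bar R :=
  ereal_sup [set z | exists (n : nat) (t : nat -> R),
    [/\ t 0%N = a, t n = b, (forall i, (i < n)%N -> t i <= t i.+1) &
        z = (\sum_(i < n) dist (gamma (t i)) (gamma (t i.+1)))%:E]].

Definition is_curve (gamma : R -> T) (a b : R) : Prop :=
  a <= b /\ mcontinuous_on gamma a b.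

Definition quasiconvex (L : R) : Prop :=
  forall x y, exists (a b : R) (gamma : R -> T),
    [/\ is_curve gamma a b, gamma a = x, gamma b = y &
        (clength gamma a b <= (L * dist x y)%:E)%E].

Definition arclength_param (gamma : R -> T) (l : R) : Prop :=
  is_curve gamma 0 l /\
  forall s t, 0 <= s -> s <= t -> t <= l -> clength gamma s t = (t - s)%:E.

End MetricMeasure.

Section Gradients.
Context {R : realType} {d : measure_display} {T : measurableType d}.
Variable dist : T -> T -> R.
Local Open Scope ereal_scope.

Definition borel_sigma : Prop := mborel dist `<=` measurable.

Definition line_integral (g : T -> \bar R) (gamma : R -> T) (l : R) : \bar R :=
  \int[lebesgue_measure]_(s in `[0%R, l]) g (gamma s).

Definition upper_gradient (u : T -> R) (g : T -> \bar R) : Prop :=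
  [/\ (forall B : set (\bar R), measurable B -> mborel dist (g @^-1` B)),
      (forall x, 0 <= g x) &
      forall (gamma : R -> T) (l : R), arclength_param dist gamma l ->
        (`|u (gamma 0%R) - u (gamma l)|%:E <= line_integral g gamma l)].

Definition mavg (nu : set T -> \bar R) (A : set T) (u : T -> R) : R :=
  (fine (\int[nu]_(x in A) (u x)%:E) / fine (nu A))%R.

Definition doubling_upto (nu : set T -> \bar R) (R0 : R) : Prop :=
  exists Cd : R, forall x (r : R), (0 < r)%R -> (r <= R0)%R ->
    0 < nu (mball dist x (2 * r)) /\
    nu (mball dist x (2 * r)) <= Cd%:E * nu (mball dist x r) /\
    nu (mball dist x r) < +oo.

Definition poincare_upto (nu : set T -> \bar R) (p lam Rb : R) : Prop :=
  exists C : R, forall (x : T) (r : R), (0 < r)%R -> (r <= Rb)%R ->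
    forall (u : T -> R) (g : T -> \bar R),
      measurable_fun setT u -> (exists K : R, forall y, (`|u y| <= K)%R) ->
      upper_gradient u g ->
      let B := mball dist x r in
      let lB := mball dist x (lam * r) in
      (fine (nu B))^-1%:E * \int[nu]_(y in B) `|u y - mavg nu B u|%:E
      <= C%:E * mdiam dist B *
         poweR ((fine (nu lB))^-1%:E * \int[nu]_(y in lB) poweR (g y) p) p^-1.

End Gradients.

(* Main.v *)
Require Import Defs.
From HB Require Import structures.
From mathcomp Require Import all_boot all_order all_algebra.
From mathcomp Require Import all_classical all_reals all_analysis measurable_realfun.
From mathcomp Require Import ring lra.
Import Order.TTheory GRing.Theory Num.Theory.
Local Open Scope classical_set_scope.
Local Open Scope ring_scope.

(** Let [Om = B(x0, L r)] and let [depth z = L r - d(x0, z)].  A point [w] on a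
    quasiconvexity curve from [y] in [B(x0, r)] to [x0] satisfies
    [d(x0, w) + d(w, y) <= L d(x0, y)], so [d(w, y) < depth w]: the curve stays
    in [Om] and Whitney balls of [Om] that meet it see [y] within a bounded
    multiple of their depth.  Joining Whitney balls along such curves to the
    central one and exchanging the order of summation bounds the integral of
    [|u - u_0|] over [B(x0, r)] by the sum over Whitney balls of their measure
    times [depth * (average of g^p)^(1/p)], and the bounded overlap of the
    dilated balls inside [Om] concludes.  Truncating at [r' < r] keeps the
    Whitney family finite.  The Whitney constant is taken so small that the
    Poincare inequality is only used at radii at most [R0]; doubling is first
    extended to all bounded radii, by covering [B(x, M)] step by step along
    chains of bounded length. *)

(** * Discrete chains in a quasiconvex metric space *)

Section Chains.
Context {R : realType} {T : Type}.
Variable dist : T -> T -> R.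
Hypothesis dist_metric : is_metric dist.

Lemma dist_ge0 x y : 0 <= dist x y.
Proof. by case: dist_metric => H _ _ _; apply: H. Qed.

Lemma dist_xx x : dist x x = 0.
Proof. by case: dist_metric => _ H _ _; apply/H. Qed.

Lemma dist_sym x y : dist x y = dist y x.
Proof. by case: dist_metric => _ _ H _; apply: H. Qed.

Lemma dist_tri y x z : dist x z <= dist x y + dist y z.
Proof. by case: dist_metric => _ _ _ H; apply: H. Qed.

Lemma dist_gt0 x y : x <> y -> 0 < dist x y.
Proof.
move=> xy; rewrite lt_neqAle dist_ge0 andbT eq_sym; apply/eqP => d0; apply: xy.
by case: dist_metric => _ H _ _; apply/H.
Qed.

Lemma mball_tri x y r s : dist x y + r <= s -> mball dist y r `<=` mball dist x s.
Proof.
move=> h z; rewrite /mball /= => yz; apply: (le_lt_trans (dist_tri y x z)).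
by apply: lt_le_trans h; rewrite ltrD2l.
Qed.

Lemma mball_le x r s : r <= s -> mball dist x r `<=` mball dist x s.
Proof. by move=> h; apply: mball_tri; rewrite dist_xx add0r. Qed.

Definition chain_len (w : nat -> T) (n : nat) : R :=
  \sum_(i < n) dist (w i) (w i.+1).

Lemma chain_lenS w n : chain_len w n.+1 = chain_len w n + dist (w n) (w n.+1).
Proof. by rewrite /chain_len big_ord_recr. Qed.

(** Iterated triangle inequality. Applied to chains from [y] to [x0], it keeps every intermediate
    point inside [Om]. *)
Lemma chain_len_dist w n k : (k <= n)%N ->
  dist (w 0%N) (w k) + dist (w k) (w n) <= chain_len w n.
Proof.
elim: n k => [|n IH] k.
  by rewrite leqn0 => /eqP ->; rewrite !dist_xx /chain_len big_ord0 addr0.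
rewrite leq_eqVlt => /orP[/eqP ->|].
  have := IH n (leqnn n); rewrite !dist_xx !addr0 chain_lenS => h.
  by have := dist_tri (w n) (w 0%N) (w n.+1); lra.
rewrite ltnS => /IH {}IH; rewrite chain_lenS.
by have := dist_tri (w n) (w k) (w n.+1); lra.
Qed.

(** Supremum argument: the endpoints [c] that admit a partition with gaps below [eta] form a set
    containing [a], and continuity at its supremum allows a further step of parameter length
    [del / 2], which would pass the supremum unless it is cut off at [b]. *)
Lemma fine_partition (gamma : R -> T) (a b eta : R) :
  is_curve dist gamma a b -> 0 < eta ->
  exists (n : nat) (t : nat -> R), [/\ t 0%N = a, t n = b,
    (forall i, (i < n)%N -> t i <= t i.+1) &
    (forall i, (i < n)%N -> dist (gamma (t i)) (gamma (t i.+1)) < eta)].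
Proof.
move=> [ab cont] eta0.
pose P c := exists (n : nat) (t : nat -> R), [/\ t 0%N = a, t n = c,
    (forall i, (i < n)%N -> t i <= t i.+1) &
    (forall i, (i < n)%N -> dist (gamma (t i)) (gamma (t i.+1)) < eta)].
have Pext c c' : P c -> c <= c' -> dist (gamma c) (gamma c') < eta -> P c'.
  move=> [n [t [t0 tn tm td]]] cc' dcc'.
  exists n.+1, (fun i => if (i <= n)%N then t i else c'); split.
  - by rewrite leq0n.
  - by rewrite ltnn.
  - move=> i; rewrite ltnS => i_n; rewrite i_n.
    case: ltnP => [h|h]; first exact: tm.
    by have -> : i = n by [apply/eqP; rewrite eqn_leq i_n]; rewrite tn.
  - move=> i; rewrite ltnS => i_n; rewrite i_n.
    case: ltnP => [h|h]; first exact: td.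
    by have -> : i = n by [apply/eqP; rewrite eqn_leq i_n]; rewrite tn.
pose S := [set c | a <= c <= b /\ P c].
have Sa : S a.
  split; first by rewrite lexx ab.
  by exists 0%N, (fun=> a); split.
have supS : has_sup S.
  by split; [exists a | exists b => c [/andP[_ h] _]].
have aS : a <= sup S by apply: ub_le_sup => //; case: supS.
have Sb : sup S <= b by apply: ge_sup; [exists a | move=> c [/andP[_ h] _]].
have aSb : a <= sup S <= b by rewrite aS Sb.
have eta2 : 0 < eta / 2 by lra.
have [del del0 hdel] := cont (sup S) aSb (eta / 2) eta2.
have [c Sc cS] := sup_adherent del0 supS.
have cleS : c <= sup S by apply: ub_le_sup => //; case: supS.
have [/andP[ac cb] Pc] := Sc.
pose c' := Num.min b (sup S + del / 2).
have c'S : sup S <= c' by rewrite le_min Sb /=; lra.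
have c'b : c' <= b by rewrite ge_min lexx.
have c'd : c' <= sup S + del / 2 by rewrite ge_min lexx orbT.
have Sc' : S c'.
  split; first by rewrite c'b andbT (le_trans aS).
  apply: (Pext c) => //; first exact: le_trans c'S.
  have h1 : dist (gamma (sup S)) (gamma c) < eta / 2.
    by apply: hdel; rewrite ?ac ?cb //; rewrite distrC ger0_norm; lra.
  have h2 : dist (gamma (sup S)) (gamma c') < eta / 2.
    apply: hdel; first by rewrite c'b (le_trans aS).
    by rewrite ger0_norm; lra.
  have := dist_tri (gamma (sup S)) (gamma c) (gamma c').
  by rewrite (dist_sym (gamma c) (gamma (sup S))); lra.
have c'eq : c' <= sup S by apply: ub_le_sup => //; case: supS.
case: Sc' => _; rewrite /c' minEle; case: ifP => // h.
by move: c'eq; rewrite /c' minEle h; lra.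
Qed.

(** Every partition sum is at most the length of the curve, so a fine sampling of a quasiconvexity
    curve is such a chain. The later geometry uses chains in place of curves. *)
Lemma quasiconvex_chain L x y (eta : R) : quasiconvex dist L -> 0 < eta ->
  exists (n : nat) (w : nat -> T), [/\ w 0%N = x, w n = y,
    (forall i, (i < n)%N -> dist (w i) (w i.+1) < eta) &
    chain_len w n <= L * dist x y].
Proof.
move=> qc eta0; have [a [b [gamma [cu ga gb len]]]] := qc x y.
have [n [t [t0 tn tm td]]] := fine_partition gamma a b eta cu eta0.
exists n, (gamma \o t); split => //=; rewrite ?t0 ?tn //.
rewrite -lee_fin; apply: le_trans len.
by apply: ereal_sup_ubound; exists n, t; split.
Qed.

Lemma quasiconvex_ge1 L (x y : T) : quasiconvex dist L -> x <> y -> 1 <= L.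
Proof.
move=> qc xy; have [n [w [w0 wn _ len]]] := quasiconvex_chain L x y 1 qc ltr01.
have := chain_len_dist w n n (leqnn n); rewrite dist_xx w0 wn addr0 => h.
by rewrite -(ler_pM2r (dist_gt0 x y xy)) mul1r; apply: le_trans len.
Qed.

Fixpoint reach (delta : R) (k : nat) (x y : T) : Prop :=
  if k is k'.+1 then exists2 w, reach delta k' x w & dist w y < delta else x = y.

Lemma reach_le delta k k' x y : 0 < delta -> (k <= k')%N ->
  reach delta k x y -> reach delta k' x y.
Proof.
move=> d0 /subnKC <-; elim: (k' - k)%N => [|j IH]; first by rewrite addn0.
by rewrite addnS => /IH h /=; exists y; rewrite ?dist_xx.
Qed.

(** The number [n] of steps of a chain is uncontrolled. Regrouping bounds it by the length alone, at
    the price of doubling the step size. *)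
Lemma chain_reach (eta : R) (w : nat -> T) n K : 0 < eta ->
  (forall i, (i < n)%N -> dist (w i) (w i.+1) < eta) ->
  chain_len w n <= K%:R * eta ->
  reach (2 * eta) K.+1 (w 0%N) (w n).
Proof.
move=> eta0 step len.
(* [v] is the last anchor; a new anchor is set once the length [e] travelled
   since [v] reaches [eta]. *)
suff [k [v [e [rk dv e_eta ke]]]] : exists k v e,
    [/\ reach (2 * eta) k (w 0%N) v, dist v (w n) <= e, 0 <= e < eta &
        k%:R * eta + e <= chain_len w n].
  apply: (@reach_le _ k.+1); first by lra.
    rewrite ltnS -(ler_nat R) -(ler_pM2r eta0).
    by apply: le_trans len; apply: le_trans ke; case/andP: e_eta => ? ?; lra.
  by exists v => //; case/andP: e_eta => ? ?; lra.
move: step {len}; elim: n => [|n IH] step.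
  exists 0%N, (w 0%N), 0; split; rewrite ?dist_xx ?lexx ?eta0 //.
  by rewrite mul0r add0r /chain_len big_ord0.
have [|k [v [e [rk dv /andP[e0 e1] ke]]]] := IH.
  by move=> i i_n; apply: step; rewrite ltnW.
have sn := step n (ltnSn n).
have tri := dist_tri (w n) v (w n.+1).
have dn0 := dist_ge0 (w n) (w n.+1).
rewrite chain_lenS; have [h|h] := ltP (e + dist (w n) (w n.+1)) eta.
  by exists k, v, (e + dist (w n) (w n.+1)); split; [| lra| lra| lra].
exists k.+1, (w n.+1), 0; split; rewrite ?dist_xx ?lexx ?eta0 //=.
  by exists v => //; lra.
by rewrite -natr1 mulrDl; lra.
Qed.

End Chains.

(** * Finite families of sets: disjointness, covering, overlap *)

Section Covering.
Context {R : realType} {d : measure_display} {T : measurableType d}.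
Variable mu : {measure set T -> \bar R}.

(** Disjointness is read off a boolean relation [e], as [pairwise] takes one; for balls, [e] is the
    separation of centres by the sum of the radii. *)
Lemma measure_disjoint_le (I : eqType) (e : rel I) (D : I -> set T)
    (s : seq I) (A : set T) :
  measurable A -> (forall i, measurable (D i)) ->
  {in s &, forall i j, e i j -> D i `&` D j = set0} -> pairwise e s ->
  {in s, forall i, D i `<=` A} ->
  (\sum_(i <- s) mu (D i) <= mu A)%E.
Proof.
elim: s A => [|i s IH] A mA mD De /=; first by rewrite big_nil.
move=> /andP[/allP ei ps] DA; rewrite big_cons.
rewrite (measureDI _ mA (mD i)) addeC (@setIidr _ A); last first.
  by apply: DA; rewrite mem_head.
rewrite leeD2r //; apply: IH => //.
- exact: measurableD.
- by move=> j k js ks; apply: De; rewrite inE ?js ?ks orbT.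
- move=> j js x Dx; split; first by apply: (DA j) => //; rewrite inE js orbT.
  move=> Dix; suff : (D i `&` D j) x by rewrite (De i j) ?inE ?eqxx ?js ?orbT ?ei.
  by [].
Qed.

Lemma integral_cover_le (I : eqType) (D : I -> set T) (s : seq I) (A : set T)
    (f : T -> \bar R) :
  measurable A -> (forall i, measurable (D i)) ->
  measurable_fun setT f -> (forall x, 0 <= f x)%E ->
  (forall x, A x -> exists2 i, i \in s & D i x) ->
  (\int[mu]_(x in A) f x <= \sum_(i <- s) \int[mu]_(x in D i) f x)%E.
Proof.
move=> mA mD mf f0; elim: s A mA => [|i s IH] A mA cov.
  have -> : A = set0 by apply/seteqP; split => // x /cov[].
  by rewrite integral_set0 big_nil.
have mfS B : measurable_fun B f by exact: measurable_funS mf.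
rewrite big_cons -(setUIDK A (D i)) ge0_integral_setU //; first last.
- by rewrite disj_set2E; apply/eqP/seteqP; split=> [x [[_ ?] [_ ?]]|].
- exact: measurableD.
- exact: measurableI.
apply: leeD; first by apply: ge0_subset_integral => //; exact: measurableI.
apply: IH; first exact: measurableD.
move=> x [Ax nDx]; have [j] := cov x Ax; rewrite inE => /orP[/eqP -> //|js Dj].
by exists j.
Qed.

Lemma measure_cover_le (I : eqType) (D : I -> set T) (s : seq I) (A : set T) :
  measurable A -> (forall i, measurable (D i)) ->
  (forall x, A x -> exists2 i, i \in s & D i x) ->
  (mu A <= \sum_(i <- s) mu (D i))%E.
Proof.
move=> mA mD cov.
have E B : measurable B -> mu B = (\int[mu]_(x in B) (cst 1%E x))%E.
  by move=> mB; rewrite integral_cst // mul1e.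
rewrite E // (eq_bigr _ (fun i _ => E (D i) (mD i))).
by apply: integral_cover_le => //; exact: measurable_cst.
Qed.

(** The left side is the integral over [A] of [f] times the number of sets [D i] containing the
    point. *)
Lemma integral_overlap_le (I : eqType) (D : I -> set T) (s : seq I)
    (A : set T) (f : T -> \bar R) (N : R) :
  measurable A -> (forall i, measurable (D i)) ->
  measurable_fun setT f -> (forall x, 0 <= f x)%E -> 0 <= N ->
  {in s, forall i, D i `<=` A} ->
  (forall x, A x -> (count (fun i => x \in D i) s)%:R <= N) ->
  (\sum_(i <- s) \int[mu]_(x in D i) f x <= N%:E * \int[mu]_(x in A) f x)%E.
Proof.
move=> mA mD mf f0 N0 DA cnt.
have mfS B : measurable_fun B f by exact: measurable_funS mf.
have m1 i : measurable_fun A (fun x => f x * (\1_(D i) x)%:E)%E.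
  apply: emeasurable_funM => //; apply/measurable_EFinP.
  exact: measurable_indic.
rewrite (eq_big_seq (fun i => \int[mu]_(x in A) (f x * (\1_(D i) x)%:E)))%E; last first.
  move=> i /DA DiA; rewrite -{1}(setIidr DiA) integral_mkcondr.
  apply: eq_integral => x _; rewrite patchE indicE.
  by case: (x \in D i); rewrite ?mule1 ?mule0.
rewrite -ge0_integral_sum //; last first.
  by move=> i x _; rewrite mule_ge0 // lee_fin.
rewrite -ge0_integralZl //; apply: ge0_le_integral => //.
- by move=> x _; apply: sume_ge0 => i _; rewrite mule_ge0 // lee_fin.
- exact: emeasurable_sum.
- exact: measurable_funeM.
move=> x Ax; rewrite -ge0_sume_distrr ?sumEFin; last first.
  by move=> i _; rewrite lee_fin.
rewrite muleC; apply: lee_wpmul2r => //; rewrite lee_fin.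
apply: le_trans (cnt x Ax); rewrite -sum1_count natr_sum [leRHS]big_mkcond /=.
by apply: ler_sum => i _; rewrite indicE; case: (x \in D i).
Qed.

End Covering.

(** Greedy extension, stopped by the bound on sizes. Keeping [s0] as a tail lets the Whitney net
    contain [x0]. *)
Lemma maximal_extension {T : Type} (good : seq T -> Prop) (N : nat) :
  (forall s, good s -> (size s <= N)%N) ->
  forall s0, good s0 -> exists s,
    good (s ++ s0) /\ forall x, ~ good (x :: s ++ s0).
Proof.
move=> bd s0 g0; move E: (N - size s0)%N => k.
elim: k s0 g0 E => [|k IH] s0 g0 E.
  exists [::]; split => // x /bd /=.
  by rewrite leqNgt ltnS -subn_eq0 E.
have [[x gx]|no] := pselect (exists x, good (x :: s0)).
  have [|s [gs mx]] := IH _ gx; first by rewrite /= subnS E.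
  by exists (rcons s x); rewrite cat_rcons.
by exists [::]; split => // x gx; apply: no; exists x.
Qed.

(** * Measures of balls and packing bounds *)

Section BallMeasure.
Context {R : realType} {d : measure_display} {Y : measurableType d}.
Variables (dist : Y -> Y -> R) (nu : {measure set Y -> \bar R}).
Hypothesis dist_metric : is_metric dist.
Hypothesis borel : borel_sigma dist.
Hypothesis balls : forall x r, 0 < r ->
  (0 < nu (mball dist x r))%E /\ (nu (mball dist x r) < +oo)%E.

Definition ballm (x : Y) (r : R) : R := fine (nu (mball dist x r)).

Lemma measurable_mball x r : measurable (mball dist x r).
Proof.
apply: borel => F [_ openF]; apply: openF => y; rewrite /mball /= => xy.
exists (r - dist x y); first by rewrite subr_gt0.
by apply: (mball_tri _ dist_metric); lra.
Qed.

Lemma ballmE x r : 0 < r -> nu (mball dist x r) = (ballm x r)%:E.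
Proof.
move=> r0; rewrite /ballm fineK // ge0_fin_numE //.
by case: (balls x r r0).
Qed.

Lemma ballm_gt0 x r : 0 < r -> 0 < ballm x r.
Proof. by move=> r0; rewrite -lte_fin -ballmE //; case: (balls x r r0). Qed.

Lemma ballm_ge0 x r : 0 <= ballm x r.
Proof. exact: fine_ge0. Qed.

Lemma ballm_le x y r s : 0 < r -> dist y x + r <= s -> ballm x r <= ballm y s.
Proof.
move=> r0 h; have s0 : 0 < s by have := dist_ge0 _ dist_metric y x; lra.
rewrite -lee_fin -!ballmE //; apply: le_measure; rewrite ?inE;
  [exact: measurable_mball|exact: measurable_mball|exact: mball_tri].
Qed.

Lemma ballm_packing (rad : Y -> R) (s : seq Y) z M : 0 < M ->
  {in s, forall v, 0 < rad v /\ dist z v + rad v <= M} ->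
  pairwise (fun v w => rad v + rad w <= dist v w) s ->
  \sum_(v <- s) ballm v (rad v) <= ballm z M.
Proof.
move=> M0 sM sep; rewrite -lee_fin -ballmE // -sumEFin.
rewrite (eq_big_seq (fun v => nu (mball dist v (rad v)))); last first.
  by move=> v /sM[? ?]; rewrite ballmE.
apply: (@measure_disjoint_le _ _ _ nu _ (fun v w => rad v + rad w <= dist v w)) => //.
- exact: measurable_mball.
- by move=> v; exact: measurable_mball.
- move=> v w _ _ vw; apply/seteqP; split => // y [] /=.
  rewrite /mball /= => h1 h2.
  by have := dist_tri _ dist_metric y v w; rewrite (dist_sym _ dist_metric y w); lra.
- by move=> v /sM[_ h]; exact: mball_tri.
Qed.

(** The balls are disjoint in [B(z, M)], and each carries at least the fraction [1 / K] of its
    measure. *)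
Lemma size_packing (rad : Y -> R) (s : seq Y) z M K : 0 < M -> 0 <= K ->
  {in s, forall v, [/\ 0 < rad v, dist z v + rad v <= M &
                      ballm z M <= K * ballm v (rad v)]} ->
  pairwise (fun v w => rad v + rad w <= dist v w) s ->
  (size s)%:R <= K.
Proof.
move=> M0 K0 sM sep; rewrite -(ler_pM2r (ballm_gt0 z M M0)).
apply: (@le_trans _ _ (K * \sum_(v <- s) ballm v (rad v))); last first.
  by apply: ler_wpM2l => //; apply: ballm_packing => // v /sM[].
rewrite mulr_sumr mulr_natl -(count_predT s) -iter_addr_0 -big_const_seq.
rewrite !(big_seq_cond xpredT) /=; apply: ler_sum => v.
by rewrite andbT => /sM[].
Qed.

(** * Doubling at all bounded radii *)

Section Growth.
Variables (L R0 Cd : R).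
Hypotheses (qc : quasiconvex dist L) (R0_gt0 : 0 < R0) (Cd0 : 0 <= Cd).
Hypothesis doubling : forall x r, 0 < r -> r <= R0 ->
  ballm x (2 * r) <= Cd * ballm x r.

Lemma doubling_iter n x r : 0 < r -> 2 ^+ n * r <= 2 * R0 ->
  ballm x (2 ^+ n * r) <= Cd ^+ n * ballm x r.
Proof.
elim: n => [|n IH] r0 h; first by rewrite !expr0 !mul1r.
have p0 : 0 < 2 ^+ n * r :> R by rewrite mulr_gt0 // exprn_gt0.
move: h; rewrite !exprS -!mulrA => h.
apply: le_trans (doubling x _ p0 _) _; first by lra.
by apply: ler_wpM2l => //; apply: IH => //; lra.
Qed.

(** The centres form a maximal [delta]-separated subset of [B(z, 2 delta)]. Their balls of radius
    [delta / 2] are disjoint in [B(z, 4 delta)]; the exponent 3 counts one doubling from [delta / 2]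
    to [delta] and two from [delta] to [4 delta]. *)
Lemma ball_cover (delta : R) z : 0 < delta -> 4 * delta <= R0 ->
  exists s : seq Y,
    (forall y, dist z y < 2 * delta -> exists2 v, v \in s & dist v y < delta) /\
    \sum_(v <- s) ballm v delta <= Cd ^+ 3 * ballm z delta.
Proof.
move=> d0 d4.
pose good (s : seq Y) := {in s, forall v, dist z v < 2 * delta} /\
  pairwise (fun v w => delta / 2 + delta / 2 <= dist v w) s.
have C4 : 0 <= Cd ^+ 4 by exact: exprn_ge0.
have bd s : good s -> (size s <= Num.bound (Cd ^+ 4))%N.
  move=> [sz sep]; rewrite -(ler_nat R); apply: le_trans (ltW (archi_boundP C4)).
  apply: (size_packing (fun=> delta / 2) s z (4 * delta)) => //; first by lra.
  move=> v /sz zv; split; [lra|lra|].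
  apply: (@le_trans _ _ (ballm v (2 ^+ 4 * (delta / 2)))).
    by apply: ballm_le; rewrite ?(dist_sym _ dist_metric v z); lra.
  by apply: doubling_iter; lra.
have [|s [[sz sep] mx]] := maximal_extension good _ bd [::]; first by [].
rewrite cats0 in sz sep mx; exists s; split.
  move=> y zy; have [//|no] := pselect (exists2 v, v \in s & dist v y < delta).
  exfalso; apply: (mx y); split.
    by move=> v; rewrite inE => /orP[/eqP ->//|/sz].
  rewrite /= sep andbT; apply/allP => v vs.
  rewrite leNgt; apply/negP => h; apply: no; exists v => //.
  by rewrite (dist_sym _ dist_metric); lra.
apply: (@le_trans _ _ (Cd * \sum_(v <- s) ballm v (delta / 2))).
  rewrite mulr_sumr; apply: ler_sum => v _.
  have -> : ballm v delta = ballm v (2 * (delta / 2)) by congr ballm; lra.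
  by apply: doubling; lra.
rewrite exprS -mulrA; apply: ler_wpM2l => //.
apply: (@le_trans _ _ (ballm z (2 ^+ 2 * delta))); last by apply: doubling_iter; lra.
apply: ballm_packing => //; first by lra.
by move=> v /sz ?; split; lra.
Qed.

(** A point reached in [k + 1] steps lies within [2 delta] of a centre of the [k]-step cover, so
    [ball_cover] is applied at each such centre. Bounding the sum of measures, not the number of
    balls, avoids comparing balls with distant centres. *)
Lemma reach_cover (delta : R) k x : 0 < delta -> 4 * delta <= R0 ->
  exists s : seq Y,
    (forall y, reach dist delta k x y -> exists2 v, v \in s & dist v y < delta) /\
    \sum_(v <- s) ballm v delta <= (Cd ^+ 3) ^+ k * ballm x delta.
Proof.
move=> d0 d4; elim: k => [|k [s [cov sum]]].
  exists [:: x]; split; last by rewrite big_seq1 expr0 mul1r.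
  by move=> y /= <-; exists x; rewrite ?mem_head // (dist_xx _ dist_metric).
have [f fP] := choice (fun z => ball_cover delta z d0 d4).
exists (flatten (map f s)); split.
  move=> y [w /cov[v vs vw] wy].
  have [|t tf ty] := (fP v).1 y.
    by have := dist_tri _ dist_metric w v y; lra.
  by exists t => //; apply/flatten_mapP; exists v.
rewrite big_flatten big_map exprS -mulrA.
apply: (@le_trans _ _ (\sum_(v <- s) Cd ^+ 3 * ballm v delta)).
  by apply: ler_sum => v _; apply: (fP v).2.
by rewrite -mulr_sumr; apply: ler_wpM2l => //; exact: exprn_ge0.
Qed.

Lemma large_ball M : 0 < M ->
  exists2 C, 0 <= C & forall x, ballm x M <= C * ballm x (R0 / 4).
Proof.
(* Regrouped steps then have size [2 eta = R0 / 4], the largest that [reach_cover] admits. The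
   absolute value of [L] is taken because its sign is not known here. *)
move=> M0; pose eta := R0 / 8; have eta0 : 0 < eta by rewrite divr_gt0.
pose K := Num.bound (`|L| * M / eta).
have LK : `|L| * M <= K%:R * eta.
  rewrite -ler_pdivrMr //; apply/ltW/archi_boundP.
  by rewrite divr_ge0 ?mulr_ge0 // ltW.
exists ((Cd ^+ 3) ^+ K.+1); first by do 2 apply: exprn_ge0.
move=> x; have d0 : 0 < 2 * eta by lra.
have -> : R0 / 4 = 2 * eta by rewrite /eta; lra.
have [|s [cov sum]] := reach_cover (2 * eta) K.+1 x d0; first by rewrite /eta; lra.
apply: le_trans sum; rewrite -lee_fin -ballmE // -sumEFin.
rewrite (eq_bigr (fun v => nu (mball dist v (2 * eta)))); last first.
  by move=> v _; rewrite ballmE.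
apply: measure_cover_le; [exact: measurable_mball|move=> v; exact: measurable_mball|].
move=> y; rewrite /mball /= => xy; apply: cov.
have [n [w [w0 wn step len]]] := quasiconvex_chain _ dist_metric L x y eta qc eta0.
rewrite -w0 -wn; apply: chain_reach => //.
apply: le_trans len _; apply: le_trans LK.
apply: (@le_trans _ _ (`|L| * dist x y)).
  by apply: ler_wpM2r; [exact: dist_ge0|exact: ler_norm].
by apply: ler_wpM2l => //; exact: ltW.
Qed.

(** For [r] above [R0], the ball [B(x, 2 r)] lies in [B(x, 2 M)] while [B(x, r)] contains
    [B(x, R0 / 4)], so [large_ball] compares the two. *)
Lemma doubling_upto_any M : exists2 C, 0 <= C & forall x r, 0 < r -> r <= M ->
  ballm x (2 * r) <= C * ballm x r.
Proof.
have [M0|M0] := leP M 0; first by exists 0 => // x r r0 rM; exfalso; lra.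
have M2 : 0 < 2 * M by lra.
have [C C0 CP] := large_ball (2 * M) M2.
exists (Cd + C) => [|x r r0 rM]; first by rewrite addr_ge0.
rewrite [leRHS]mulrDl; have b0 := ballm_ge0 x r.
have [h|h] := leP r R0.
  apply: le_trans (doubling x r r0 h) _.
  by rewrite lerDl mulr_ge0.
apply: (@le_trans _ _ (C * ballm x r)); last by rewrite lerDr mulr_ge0.
apply: (@le_trans _ _ (ballm x (2 * M))).
  by apply: ballm_le; rewrite ?(dist_xx _ dist_metric); lra.
apply: le_trans (CP x) _; apply: ler_wpM2l => //; move: R0_gt0 => R0p.
by apply: ballm_le; rewrite ?(dist_xx _ dist_metric); lra.
Qed.

Lemma ballm_growth kappa M : 0 < kappa ->
  exists2 C, 0 <= C & forall x r, 0 < r -> r <= M ->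
    ballm x (kappa * r) <= C * ballm x r.
Proof.
move=> k0; pose n := Num.bound kappa.
suff [C C0 CP] : exists2 C, 0 <= C & forall x r, 0 < r -> r <= M ->
    ballm x (2 ^+ n * r) <= C * ballm x r.
  exists C => // x r r0 rM; apply: le_trans (CP x r r0 rM).
  apply: ballm_le; rewrite ?mulr_gt0 // (dist_xx _ dist_metric) add0r ler_pM2r //.
  apply: le_trans (ltW (archi_boundP (ltW k0))) _.
  by rewrite -natrX ler_nat ltnW // ltn_expl.
elim: n => [|n [C C0 CP]]; first by exists 1 => // x r _ _; rewrite expr0 !mul1r.
have [C' C'0 CP'] := doubling_upto_any (2 ^+ n * M).
exists (C' * C); first exact: mulr_ge0.
move=> x r r0 rM; rewrite exprS -!mulrA.
have p0 : 0 < 2 ^+ n :> R by exact: exprn_gt0.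
apply: (@le_trans _ _ (C' * ballm x (2 ^+ n * r))).
  by apply: CP'; rewrite ?mulr_gt0 ?ler_pM2l.
by apply: ler_wpM2l => //; exact: CP.
Qed.

End Growth.
End BallMeasure.

(** * Oscillation of a bounded function about a constant *)

Section Oscillation.
Context {R : realType} {d : measure_display} {T : measurableType d}.
Variables (mu : {measure set T -> \bar R}) (u : T -> R) (K : R).
Hypotheses (mu_u : measurable_fun setT u) (u_bd : forall y, `|u y| <= K).

(** The constant [c] is arbitrary so that averages over different balls can be exchanged. The value
    is real for linear arithmetic; by [oscE], [fine] loses nothing on measurable sets of finite
    measure. *)
Definition osc (A : set T) (c : R) : R := fine (\int[mu]_(y in A) `|u y - c|%:E).

Lemma integrable_bounded (f : T -> R) (M : R) (A : set T) :
  measurable_fun setT f -> (forall y, `|f y| <= M) ->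
  measurable A -> (mu A < +oo)%E -> mu.-integrable A (EFin \o f).
Proof.
move=> mf fM mA fA; apply: measurable_bounded_integrable => //.
  exact: measurable_funS mf.
by exists M; split; [exact: num_real|move=> N MN y _; exact: le_trans (fM y) (ltW MN)].
Qed.

Lemma measurable_fun_osc c : measurable_fun setT (fun y => `|u y - c|).
Proof.
apply: measurableT_comp => //=.
by apply: measurable_funB => //; exact: measurable_cst.
Qed.

Lemma integrable_osc (A : set T) c : measurable A -> (mu A < +oo)%E ->
  mu.-integrable A (EFin \o (fun y => `|u y - c|)).
Proof.
apply: (@integrable_bounded _ (K + `|c|)); first exact: measurable_fun_osc.
by move=> y; rewrite normr_id (le_trans (ler_normB _ _)) // lerD2r.
Qed.

Lemma oscE A c : measurable A -> (mu A < +oo)%E ->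
  (\int[mu]_(y in A) `|u y - c|%:E = (osc A c)%:E)%E.
Proof.
move=> mA fA; rewrite /osc fineK //.
by apply: integrable_fin_num => //; exact: integrable_osc.
Qed.

Lemma osc_le A B c : measurable A -> measurable B -> (mu B < +oo)%E ->
  A `<=` B -> osc A c <= osc B c.
Proof.
move=> mA mB fB AB.
have fA : (mu A < +oo)%E by apply: le_lt_trans fB; apply: le_measure; rewrite ?inE.
rewrite -lee_fin -!oscE //; apply: ge0_subset_integral => //.
by apply/measurable_EFinP; exact: measurable_funS (measurable_fun_osc c).
Qed.

Lemma integrable_cst_fin A (c : R) : measurable A -> (mu A < +oo)%E ->
  mu.-integrable A (EFin \o (fun=> c)).
Proof.
apply: (@integrable_bounded _ `|c|) => //; exact: measurable_cst.
Qed.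

Lemma osc_tri A c c' : measurable A -> (mu A < +oo)%E ->
  osc A c <= osc A c' + fine (mu A) * `|c' - c|.
Proof.
move=> mA fA; rewrite (mulrC (fine _)) -(Rintegral_cst mu mA).
rewrite /osc -/(Rintegral mu A (fun y => `|u y - c|))
  -/(Rintegral mu A (fun y => `|u y - c'|)) -RintegralD //.
- apply: le_Rintegral => //; first exact: integrable_osc.
    apply: (@integrable_bounded _ (K + `|c'| + `|c' - c|)) => //.
      apply: measurable_funD; first exact: measurable_fun_osc.
      exact: measurable_cst.
    move=> y; rewrite ger0_norm ?addr_ge0 // lerD2r.
    by rewrite (le_trans (ler_normB _ _)) // lerD2r.
  move=> y _; have -> : u y - c = (u y - c') + (c' - c) by lra.
  exact: ler_normD.
- exact: integrable_osc.
- exact: integrable_cst_fin.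
Qed.

Lemma osc_avg A c : measurable A -> (mu A < +oo)%E -> (0 < mu A)%E ->
  fine (mu A) * `|mavg mu A u - c| <= osc A c.
Proof.
move=> mA fA pA; have m0 : 0 < fine (mu A) by apply: fine_gt0; rewrite pA.
have iu : mu.-integrable A (EFin \o u) by apply: (@integrable_bounded _ K).
rewrite -{1}(gtr0_norm m0) -normrM /mavg -/(Rintegral mu A u).
rewrite mulrBr mulrCA mulfV ?gt_eqF // mulr1 (mulrC _ c).
rewrite -(Rintegral_cst mu mA) -RintegralB //; last exact: integrable_cst_fin.
apply: le_normr_Rintegral => //.
apply: (@integrable_bounded _ (K + `|c|)) => //.
  by apply: measurable_funB => //; exact: measurable_cst.
by move=> y; rewrite (le_trans (ler_normB _ _)) // lerD2r.
Qed.

Lemma osc_cover (I : eqType) (D : I -> set T) (s : seq I) A c :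
  measurable A -> (mu A < +oo)%E ->
  (forall i, measurable (D i)) -> (forall i, i \in s -> (mu (D i) < +oo)%E) ->
  (forall x, A x -> exists2 i, i \in s & D i x) ->
  osc A c <= \sum_(i <- s) osc (D i) c.
Proof.
move=> mA fA mD fD cov; rewrite -lee_fin -oscE // -sumEFin.
rewrite (eq_big_seq (fun i => \int[mu]_(y in D i) `|u y - c|%:E))%E; last first.
  by move=> i si; rewrite oscE // fD.
apply: integral_cover_le => //; first by apply/measurable_EFinP; exact: measurable_fun_osc.
Qed.

(** Monotone convergence along the exhaustion [F]; it lets the truncation radius [r'] increase to
    [r] at the end. *)
Lemma osc_nondecreasing_le (F : nat -> set T) A c M :
  (forall n, measurable (F n)) -> measurable A -> (mu A < +oo)%E ->
  (forall n, F n `<=` F n.+1) -> A = \bigcup_n F n ->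
  (forall n, osc (F n) c <= M) -> osc A c <= M.
Proof.
move=> mF mA fA Fnd AE bd.
have FA n : F n `<=` A by rewrite AE => x Fx; exists n.
have fF n : (mu (F n) < +oo)%E.
  by apply: le_lt_trans fA; apply: le_measure; rewrite ?inE.
have mo := measurable_fun_osc c.
have cv : (\int[mu]_(y in F n) `|u y - c|%:E)%E @[n --> \oo] -->
          (\int[mu]_(y in A) `|u y - c|%:E)%E.
  rewrite AE; apply: ge0_nondecreasing_set_cvg_integral => //.
  - by apply/nondecreasing_seqP => n; apply/subsetPset; exact: Fnd.
  - by move=> n; apply/measurable_EFinP; exact: measurable_funS mo.
rewrite -lee_fin -oscE //; rewrite -(cvg_lim _ cv) //.
apply: lime_le; first by apply/cvg_ex; eexists; exact: cv.
by apply: nearW => n; rewrite oscE // lee_fin.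
Qed.

End Oscillation.

(* Taking [A] to be the average of [g^p], this plays the role of Hoelder's
   inequality in the summation over Whitney balls. *)
Lemma powR_le_affine {R : realType} (p A t : R) : 1 <= p -> 0 < A -> 0 <= t ->
  t `^ p^-1 <= A `^ p^-1 * (1 + t / A).
Proof.
move=> p1 A0 t0; have p0 : 0 < p by lra.
have q0 : 0 <= t / A by rewrite divr_ge0 // ltW.
(* By homogeneity only [q = t / A] matters: its power is at most 1 if [q <= 1], and at most [q]
   otherwise. *)
have -> : t = A * (t / A) by rewrite mulrCA mulfV ?mulr1 ?gt_eqF.
rewrite powRM ?(ltW A0) // (_ : A * (t / A) / A = t / A); last first.
  by rewrite mulrAC mulfV ?mul1r ?gt_eqF.
apply: ler_wpM2l; first exact: powR_ge0.
have pV : 0 <= p^-1 by rewrite invr_ge0 ltW.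
have [q1|q1] := leP (t / A) 1.
  apply: (@le_trans _ _ (1 `^ p^-1)); last by rewrite powR1 lerDl.
  by apply: ge0_ler_powR; rewrite ?nnegrE.
apply: (@le_trans _ _ ((t / A) `^ 1)); last by rewrite powRr1 // lerDr.
by apply: ler_powR; [exact: ltW|rewrite invf_le1].
Qed.

(** * Whitney balls and the comparison of their averages *)

Section WhitneyChain.
Context {R : realType} {d : measure_display} {Y : measurableType d}.
Variables (dist : Y -> Y -> R) (nu : {measure set Y -> \bar R}).
Hypothesis dist_metric : is_metric dist.
Hypothesis borel : borel_sigma dist.
Hypothesis balls : forall x r, 0 < r ->
  (0 < nu (mball dist x r))%E /\ (nu (mball dist x r) < +oo)%E.
Variables (L lam c p Cg C0 r K : R) (x0 : Y) (u : Y -> R) (h : Y -> \bar R).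
Hypotheses (qc : quasiconvex dist L) (L1 : 1 <= L) (lam1 : 1 <= lam).
Hypotheses (c_gt0 : 0 < c) (c_small : 48 * (c * lam) <= 1) (p1 : 1 <= p).
Hypotheses (Cg0 : 0 <= Cg) (C00 : 0 <= C0) (r_gt0 : 0 < r).
Hypotheses (mu_u : measurable_fun setT u) (u_bd : forall y, `|u y| <= K).
Hypotheses (mh : measurable_fun setT h) (h0 : forall y, (0 <= h y)%E).
Hypothesis h_fin : (\int[nu]_(y in mball dist x0 (L * r)) h y < +oo)%E.

Local Notation ballm := (ballm dist nu).

(* The Whitney ball at [z] is [B(z, 4 wrad z)]; the balls [B(z, wrad z)] centred
   at net points are disjoint, and the Poincare inequality is applied on
   [B(z, 24 wrad z)], which contains the adjacent Whitney balls. *)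
Definition depth (z : Y) : R := L * r - dist x0 z.
Definition wrad (z : Y) : R := c * depth z.
Definition hmass (z : Y) : R :=
  fine (\int[nu]_(y in mball dist z (lam * (24 * wrad z))) h y).
Definition wgrad (z : Y) : R :=
  depth z * (hmass z / ballm z (lam * (24 * wrad z))) `^ p^-1.
Definition wavg (z : Y) : R := mavg nu (mball dist z (4 * wrad z)) u.

Hypothesis growth : forall z s, 0 < s -> s <= L * r ->
  ballm z (4 * s) <= Cg * ballm z (c * s).
Hypothesis growth_any : forall kappa, 0 < kappa ->
  exists2 C, 0 <= C & forall z s, 0 < s -> s <= L * r ->
    ballm z (kappa * s) <= C * ballm z s.
Hypothesis poincare : forall z, 0 < depth z ->
  let V := mball dist z (24 * wrad z) in
  osc nu u V (mavg nu V u) <= C0 * ballm z (24 * wrad z) * wgrad z.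

Local Notation dge0 := (dist_ge0 dist dist_metric).
Local Notation dsym := (dist_sym dist dist_metric).
Local Notation dtri := (dist_tri dist dist_metric).
Local Notation mB := (measurable_mball dist dist_metric borel).

Let fB x s : 0 < s -> (nu (mball dist x s) < +oo)%E.
Proof. by move=> s0; case: (balls x s s0). Qed.
Let pB x s : 0 < s -> (0 < nu (mball dist x s))%E.
Proof. by move=> s0; case: (balls x s s0). Qed.

Lemma c_le_inv48 : 48 * c <= 1.
Proof.
apply: le_trans c_small; rewrite ler_pM2l // -{1}(mulr1 c).
by rewrite ler_pM2l.
Qed.

Lemma depth_le z : depth z <= L * r.
Proof. by have := dge0 x0 z; rewrite /depth; lra. Qed.

Lemma depth_lip z w : depth w <= depth z + dist z w.
Proof. by have := dtri w x0 z; rewrite (dsym w z) /depth; lra. Qed.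

(** [depth] is 1-Lipschitz and [c <= 1/48]; hence adjacent Whitney balls have comparable radii. *)
Lemma wrad_lip z w : wrad w <= wrad z + dist z w / 48.
Proof.
have h1 : c * depth w <= c * (depth z + dist z w).
  by apply: ler_wpM2l (depth_lip z w); exact: ltW.
have h2 : 48 * c * dist z w <= 1 * dist z w.
  by apply: ler_wpM2r c_le_inv48; exact: dge0.
by rewrite /wrad; move: h1 h2; rewrite mulrDr -mulrA; lra.
Qed.

Lemma wrad_gt0 z : 0 < depth z -> 0 < wrad z.
Proof. by move=> z0; rewrite mulr_gt0. Qed.

Lemma wrad_le z : 0 < depth z -> 48 * wrad z <= depth z.
Proof.
move=> z0; rewrite /wrad mulrA -[leRHS]mul1r; apply: ler_wpM2r c_le_inv48.
exact: ltW.
Qed.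

(** The purpose of [c_small]: a dilated Poincare ball uses at most half the depth of its centre, so
    it stays in [Om] and its points have depth comparable to that of the centre. *)
Lemma lam_wrad_le z : 0 < depth z -> lam * (24 * wrad z) <= depth z / 2.
Proof.
move=> z0; have : 48 * (c * lam) * depth z <= 1 * depth z.
  by apply: ler_wpM2r c_small; exact: ltW.
rewrite /wrad; have -> : lam * (24 * (c * depth z)) = 24 * (c * lam * depth z).
  by ring.
by rewrite -!mulrA; lra.
Qed.

Lemma lam_wrad_ge z : 0 < depth z -> 24 * wrad z <= lam * (24 * wrad z).
Proof.
move=> z0; rewrite -{1}[24 * wrad z]mul1r; apply: ler_wpM2r => //.
by have := wrad_gt0 z z0; lra.
Qed.

Lemma wgrad_ge0 z : 0 < depth z -> 0 <= wgrad z.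
Proof. by move=> z0; rewrite mulr_ge0 ?powR_ge0 // ltW. Qed.

Lemma ballm_depth z : 0 < depth z -> ballm z (4 * depth z) <= Cg * ballm z (wrad z).
Proof. by move=> z0; apply: growth => //; exact: depth_le. Qed.

Lemma osc_near z z' : 0 < depth z -> 0 < depth z' ->
  dist z z' + 4 * wrad z' <= 24 * wrad z ->
  ballm z' (4 * wrad z') * `|wavg z' - mavg nu (mball dist z (24 * wrad z)) u|
    <= C0 * ballm z (24 * wrad z) * wgrad z.
Proof.
move=> z0 z'0 hz; set V := mball dist z (24 * wrad z).
have k0 := wrad_gt0 z z0; have k'0 := wrad_gt0 z' z'0.
apply: le_trans (poincare z z0); rewrite -/V.
apply: (@le_trans _ _ (osc nu u (mball dist z' (4 * wrad z')) (mavg nu V u))).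
  by apply: (osc_avg _ _ K) => //; [exact: mB|apply: fB; lra|apply: pB; lra].
apply: (osc_le _ _ K) => //; [exact: mB|exact: mB|apply: fB; lra|].
exact: (mball_tri _ dist_metric).
Qed.

Lemma wavg_near z z' : 0 < depth z -> 0 < depth z' ->
  dist z z' + 4 * wrad z' <= 24 * wrad z ->
  `|wavg z' - mavg nu (mball dist z (24 * wrad z)) u| <= C0 * Cg * wgrad z.
Proof.
move=> z0 z'0 hz; have k0 := wrad_gt0 z z0; have k'0 := wrad_gt0 z' z'0.
have b0 : 0 < ballm z' (4 * wrad z') by apply: ballm_gt0 => //; lra.
rewrite -(ler_pM2l b0); apply: le_trans (osc_near z z' z0 z'0 hz) _.
rewrite [leRHS]mulrA; apply: ler_wpM2r; first exact: wgrad_ge0.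
rewrite [leRHS]mulrCA; apply: ler_wpM2l => //; rewrite [leRHS]mulrC.
have le1 := wrad_le z z0; have lip := depth_lip z' z.
have dd := dge0 z z'; rewrite (dsym z' z) in lip.
(* [z'] is at least half as deep as [z], so [B(z, 24 wrad z)] lies in [B(z', 4 depth z')], whose
   measure [growth] controls. *)
apply: (@le_trans _ _ (ballm z' (4 * depth z'))).
  by apply: ballm_le => //; rewrite ?(dsym z' z); lra.
apply: le_trans (ballm_depth z' z'0) _; apply: ler_wpM2l => //.
by apply: ballm_le => //; rewrite ?dist_xx //; lra.
Qed.

(** The factor 5, against 4 in the Whitney radius, leaves room for the gap between consecutive chain
    points: their Whitney balls need not intersect. *)
Definition wadj (z z' : Y) : bool := dist z z' < 5 * wrad z + 5 * wrad z'.

(** By [wrad_lip] the ball [B(z, 24 wrad z)] contains both Whitney balls, and its average serves as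
    intermediary. *)
Lemma wavg_adj z z' : 0 < depth z -> 0 < depth z' -> wadj z z' ->
  `|wavg z - wavg z'| <= 2 * (C0 * Cg) * wgrad z.
Proof.
move=> z0 z'0; rewrite /wadj => adj.
have k0 := wrad_gt0 z z0; have k'0 := wrad_gt0 z' z'0.
have lip := wrad_lip z z'.
have h1 : dist z z + 4 * wrad z <= 24 * wrad z by rewrite dist_xx //; lra.
have h2 : dist z z' + 4 * wrad z' <= 24 * wrad z by lra.
have := wavg_near z z z0 z0 h1; have := wavg_near z z' z0 z'0 h2.
set V := mavg _ _ _ => e1 e2.
have -> : wavg z - wavg z' = (wavg z - V) - (wavg z' - V) by lra.
by apply: le_trans (ler_normB _ _) _; lra.
Qed.

Lemma wavg_path z t : {in z :: t, forall v, 0 < depth v} -> path wadj z t ->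
  `|wavg z - wavg (last z t)| <= 2 * (C0 * Cg) * \sum_(v <- z :: t) wgrad v.
Proof.
have C2 : 0 <= 2 * (C0 * Cg) by rewrite !mulr_ge0.
elim: t z => [|z' t IH] z dp /=.
  move=> _; rewrite subrr normr0 big_seq1; apply: mulr_ge0 => //.
  by apply: wgrad_ge0; apply: dp; rewrite mem_head.
move=> /andP[adj pt]; rewrite big_cons mulrDr.
have z0 : 0 < depth z by apply: dp; rewrite mem_head.
have z'0 : 0 < depth z' by apply: dp; rewrite !inE eqxx orbT.
have -> : wavg z - wavg (last z' t) = (wavg z - wavg z') + (wavg z' - wavg (last z' t)).
  by lra.
apply: le_trans (ler_normD _ _) _; apply: lerD; first exact: wavg_adj.
by apply: IH => // v vt; apply: dp; rewrite inE vt orbT.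
Qed.

(** The constant is changed from [c0] to the ball's own average, then to the average over [V], where
    [poincare] applies; [e3] and [e4] account for [2 * C0]. *)
Lemma osc_whitney z c0 : 0 < depth z ->
  osc nu u (mball dist z (4 * wrad z)) c0 <=
    Cg * ballm z (wrad z) * (2 * C0 * wgrad z + `|wavg z - c0|).
Proof.
move=> z0; have k0 := wrad_gt0 z z0; have le1 := wrad_le z z0.
have bV : ballm z (24 * wrad z) <= Cg * ballm z (wrad z).
  apply: le_trans (ballm_depth z z0).
  by apply: ballm_le => //; rewrite ?dist_xx //; lra.
have bW : ballm z (4 * wrad z) <= Cg * ballm z (wrad z).
  by apply: le_trans bV; apply: ballm_le => //; rewrite ?dist_xx //; lra.
set W := mball dist z (4 * wrad z); set V := mball dist z (24 * wrad z).
have fW : (nu W < +oo)%E by apply: fB; lra.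
have fV : (nu V < +oo)%E by apply: fB; lra.
have e1 : osc nu u W c0 <= osc nu u W (wavg z) + ballm z (4 * wrad z) * `|wavg z - c0|.
  by apply: (osc_tri _ _ K) => //; exact: mB.
have e2 : osc nu u W (wavg z) <= osc nu u W (mavg nu V u) +
    ballm z (4 * wrad z) * `|mavg nu V u - wavg z|.
  by apply: (osc_tri _ _ K) => //; exact: mB.
have e3 : osc nu u W (mavg nu V u) <= C0 * ballm z (24 * wrad z) * wgrad z.
  apply: le_trans (poincare z z0); apply: (osc_le _ _ K) => //; try exact: mB.
  by apply: mball_le => //; lra.
have e4 : ballm z (4 * wrad z) * `|mavg nu V u - wavg z| <=
    C0 * ballm z (24 * wrad z) * wgrad z.
  by rewrite distrC; apply: osc_near => //; rewrite dist_xx //; lra.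
have e5 : C0 * ballm z (24 * wrad z) * wgrad z <= Cg * ballm z (wrad z) * (C0 * wgrad z).
  have -> : C0 * ballm z (24 * wrad z) * wgrad z =
    ballm z (24 * wrad z) * (C0 * wgrad z) by ring.
  apply: ler_wpM2r => //.
  by rewrite mulr_ge0 ?wgrad_ge0.
have e6 : ballm z (4 * wrad z) * `|wavg z - c0| <= Cg * ballm z (wrad z) * `|wavg z - c0|.
  exact: ler_wpM2r.
by lra.
Qed.

(** * Truncation at [r']: finite nets, paths of balls, summation *)

Section Net.
Variable r' : R.
Hypotheses (r'0 : 0 < r') (r'r : r' < r).

Lemma depth_net z : dist x0 z <= L * r' -> L * (r - r') <= depth z.
Proof. by rewrite /depth mulrBr; lra. Qed.

Lemma net_depth_gt0 : 0 < L * (r - r').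
Proof. by move: L1 r'r => *; apply: mulr_gt0; lra. Qed.

(** A maximal family with disjoint balls [B(z, wrad z)], grown from [x0]. It is finite because
    [depth], hence [wrad], is bounded below where [dist x0 z <= L * r']. *)
Lemma whitney_net : exists s : seq Y,
  [/\ x0 \in s, {in s, forall z, dist x0 z <= L * r'},
      pairwise (fun v w => wrad v + wrad w <= dist v w) s &
      forall w, dist x0 w <= L * r' ->
        exists2 z, z \in s & dist z w < 4 * wrad z].
Proof.
pose good (s : seq Y) := {in s, forall z, dist x0 z <= L * r'} /\
  pairwise (fun v w => wrad v + wrad w <= dist v w) s.
have rm0 := net_depth_gt0; set rm := L * (r - r') in rm0.
have L0 : 0 < L by move: L1 => *; lra.
have Lr0 : 0 < L * r by rewrite mulr_gt0.
have crm : 0 < c * rm by exact: mulr_gt0.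
have rmL : rm <= L * r by rewrite ler_pM2l //; move: r'0 => *; lra.
have crmL : c * rm <= L * r.
  have := c_le_inv48 => h48; apply: le_trans rmL; rewrite -[leRHS]mul1r ler_pM2r //.
  by move: c_gt0 => *; lra.
(* [kappa] enlarges the least radius [c * rm] to [2 L r], enough for a ball about any net point to
   contain [B(x0, L r)]. *)
pose kappa := 2 * (L * r) / (c * rm).
have k0 : 0 < kappa by rewrite divr_gt0 // mulr_gt0.
have [C CC CP] := growth_any kappa k0.
have bd s : good s -> (size s <= Num.bound C)%N.
  move=> [sz sep]; rewrite -(ler_nat R); apply: le_trans (ltW (archi_boundP CC)).
  apply: (size_packing dist nu dist_metric borel balls wrad s x0 (L * r)) => //.
  move=> v /sz hv; have dv := depth_net v hv; rewrite -/rm in dv.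
  have v0 : 0 < depth v by apply: lt_le_trans dv.
  split; first exact: wrad_gt0.
    by have := wrad_le v v0; rewrite {1}/depth; move: v0; rewrite /depth; lra.
  apply: (@le_trans _ _ (ballm v (kappa * (c * rm)))).
    rewrite /kappa divfK ?gt_eqF //; apply: ballm_le => //.
    by move: v0; rewrite (dsym v x0) /depth; lra.
  apply: le_trans (CP v (c * rm) crm crmL) _; apply: ler_wpM2l => //.
  apply: ballm_le => //; rewrite dist_xx // add0r /wrad ler_pM2l //.
have [|s [[sz sep] mx]] := maximal_extension good _ bd [:: x0].
  split => // z; rewrite inE => /eqP ->; rewrite dist_xx //.
  by rewrite mulr_ge0 // ltW.
exists (s ++ [:: x0]); split => //; first by rewrite mem_cat mem_head orbT.
move=> w hw.
have [//|no] := pselect (exists2 z, z \in s ++ [:: x0] & dist z w < 4 * wrad z).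
exfalso; apply: (mx w); split.
  by move=> v; rewrite inE => /orP[/eqP ->//|/sz].
rewrite [pairwise _ _]/= sep andbT; apply/allP => v vs.
rewrite leNgt; apply/negP => hlt; apply: no; exists v => //.
(* If [v] and [w] are not separated, then [dist v w < 2 wrad v + dist v w / 48], which puts [w] in
   the Whitney ball of [v]. *)
have lip := wrad_lip v w; rewrite (dsym v w) in lip *.
by have := dge0 w v; lra.
Qed.

(** Each point of a fine chain from [y] to [x0] picks a net ball containing it. The steps are below
    [c * rm], a lower bound for the net radii, so consecutive balls are adjacent. The last clause
    later confines the shadow of [z] to [B(z, 4 depth z)]. *)
Lemma whitney_path (s : seq Y) i y :
  x0 \in s -> {in s, forall z, dist x0 z <= L * r'} ->
  (forall w, dist x0 w <= L * r' -> exists2 z, z \in s & dist z w < 4 * wrad z) ->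
  i \in s -> dist i y < 4 * wrad i -> dist x0 y < r' ->
  exists t : seq Y, [/\ uniq (i :: t), path wadj i t, last i t = x0,
    {subset i :: t <= s} &
    {in i :: t, forall z, dist z i + wrad i <= 4 * depth z}].
Proof.
move=> x0s sz cov is_ iy x0y.
pose Q z := z \in s /\ dist z i + wrad i <= 4 * depth z.
have rm0 := net_depth_gt0; set rm := L * (r - r') in rm0.
have sdepth z : z \in s -> rm <= depth z by move=> /sz; exact: depth_net.
have swrad z : z \in s -> c * rm <= wrad z by move=> /sdepth h'; rewrite ler_pM2l.
have crm : 0 < c * rm by exact: mulr_gt0.
have L0 : 0 < L by move: L1 => *; lra.
have i0 : 0 < depth i by apply: lt_le_trans (sdepth i is_).
have [n [w [w0 wn step len]]] := quasiconvex_chain dist dist_metric L y x0 (c * rm) qc crm.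
have wP m : (m <= n)%N -> dist y (w m) + dist x0 (w m) <= L * r'.
  move=> mn; rewrite (dsym x0 (w m)).
  have := chain_len_dist dist dist_metric w n m mn; rewrite w0 wn => h1.
  apply: le_trans h1 (le_trans len _); rewrite ler_pM2l // (dsym y x0).
  exact: ltW.
have QP z m : (m <= n)%N -> z \in s -> dist z (w m) < 4 * wrad z -> Q z.
  move=> mn zs zw; split => //.
  have z0 : 0 < depth z by apply: lt_le_trans (sdepth z zs).
  (* [y] is no farther from [w m] than the depth of [w m]; the depths of [i] and [z] are then
     compared through [y] and [w m]. *)
  have yw : dist y (w m) <= depth (w m).
    have := wP m mn; have : L * r' <= L * r by rewrite ler_pM2l // ltW.
    by rewrite /depth; lra.
  have h1 := depth_lip z (w m); have h2 := depth_lip (w m) y.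
  have h3 := depth_lip y i; have h4 := wrad_le i i0; have h5 := wrad_le z z0.
  have t1 := dtri (w m) z i; have t2 := dtri y (w m) i.
  by rewrite (dsym (w m) y) in h2 t2; rewrite (dsym y i) in h3 t2; lra.
have adjP z z' v v' : z \in s -> z' \in s -> dist z v < 4 * wrad z ->
    dist z' v' < 4 * wrad z' -> dist v v' < c * rm -> wadj z z'.
  move=> zs z's zv z'v' vv'; have h1 := swrad z zs; have h2 := swrad z' z's.
  have t1 := dtri v z z'; have t2 := dtri v' v z'; rewrite (dsym v' z') in t2.
  by rewrite /wadj; lra.
have Qi : Q i by apply: (QP i 0%N) => //; rewrite w0.
have chain m : (m <= n)%N -> exists t : seq Y, [/\ {in i :: t, forall z, Q z},
    path wadj i t & dist (last i t) (w m) < 4 * wrad (last i t)].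
  elim: m => [_|m IH mn].
    by exists [::]; split => //=; [move=> z; rewrite inE => /eqP ->|rewrite w0].
  have [t [tQ pt lt]] := IH (ltnW mn).
  have [|z zs zw] := cov (w m.+1).
    by have := wP _ mn; have := dge0 y (w m.+1); lra.
  exists (rcons t z); split; last by rewrite last_rcons.
    move=> v; rewrite -rcons_cons mem_rcons inE => /orP[/eqP ->|/tQ //].
    exact: (QP z m.+1).
  rewrite rcons_path pt /=; apply: (adjP _ _ (w m) (w m.+1)) => //; last exact: step.
  by have [] := tQ _ (mem_last i t).
have [t [tQ pt lt]] := chain n (leqnn n).
have dx0 : 0 < depth x0 by apply: lt_le_trans (sdepth _ x0s).
have x0W : dist x0 x0 < 4 * wrad x0.
  by rewrite dist_xx //; have := wrad_gt0 x0 dx0; lra.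
have pt' : path wadj i (rcons t x0).
  rewrite rcons_path pt /=; apply: (adjP _ _ (w n) x0) => //.
    by have [] := tQ _ (mem_last i t).
  by rewrite wn dist_xx.
have Q' : {in i :: rcons t x0, forall z, Q z}.
  move=> v; rewrite -rcons_cons mem_rcons inE => /orP[/eqP ->|/tQ //].
  by apply: (QP x0 n) => //; rewrite wn.
have lx0 : last i (rcons t x0) = x0 by rewrite last_rcons.
(* Loops are cut out so that the sum along a path becomes a sum over distinct members of the net, as
   the exchange of sums requires. *)
case: (shortenP pt') lx0 => t' pt'' ut' sub lx0.
have Q'' : {in i :: t', forall z, Q z}.
  move=> v; rewrite inE => /orP[/eqP -> //|/sub vt]; apply: Q'.
  by rewrite inE vt orbT.
by exists t'; split => // z /Q''[].
Qed.

Lemma sep_uniq (s : seq Y) : {in s, forall z, 0 < depth z} ->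
  pairwise (fun v w => wrad v + wrad w <= dist v w) s -> uniq s.
Proof.
elim: s => //= z s IH dp /andP[/allP sep ps]; rewrite IH //; last first.
  by move=> v vs; apply: dp; rewrite inE vs orbT.
rewrite andbT; apply/negP => /sep; rewrite (dist_xx dist dist_metric) => ww.
have z0 : 0 < depth z by apply: dp; rewrite mem_head.
by have := wrad_gt0 z z0; lra.
Qed.

Lemma osc_net (s : seq Y) :
  x0 \in s -> {in s, forall z, dist x0 z <= L * r'} ->
  pairwise (fun v w => wrad v + wrad w <= dist v w) s ->
  (forall w, dist x0 w <= L * r' -> exists2 z, z \in s & dist z w < 4 * wrad z) ->
  osc nu u (mball dist x0 r') (wavg x0) <=
    Cg * (2 * C0 + 2 * (C0 * Cg)) * Cg * \sum_(j <- s) wgrad j * ballm j (wrad j).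
Proof.
move=> x0s sz sep cov.
have rm0 := net_depth_gt0; set rm := L * (r - r') in rm0.
have sdepth z : z \in s -> 0 < depth z.
  by move=> /sz hz; apply: lt_le_trans rm0 _; exact: depth_net.
have us : uniq s by apply: sep_uniq.
pose K1 := Cg * (2 * C0 + 2 * (C0 * Cg)).
have K10 : 0 <= K1.
  by apply: mulr_ge0 => //; apply: addr_ge0; rewrite ?mulr_ge0.
(* [P] selects the net balls that meet [B(x0, r')]: they cover it, and each is the start of a path.
   For other [i] the chosen list is a dummy. *)
pose P i := `[< exists2 y, dist i y < 4 * wrad i & dist x0 y < r' >].
have chP i : exists t : seq Y, i \in s -> P i -> [/\ uniq (i :: t), path wadj i t,
    last i t = x0, {subset i :: t <= s} &
    {in i :: t, forall z, dist z i + wrad i <= 4 * depth z}].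
  have [[is_ Pi]|no] := pselect (i \in s /\ P i).
    have [y iy x0y] := asboolW Pi.
    have [t tP] := whitney_path s i y x0s sz cov is_ iy x0y.
    by exists t.
  by exists [::] => is_ Pi; exfalso; apply: no.
have [ch {}chP] := choice chP.
have LL : r' <= L * r' by rewrite -[leLHS]mul1r ler_pM2r.
apply: (@le_trans _ _ (\sum_(i <- s | P i) osc nu u (mball dist i (4 * wrad i)) (wavg x0))).
  rewrite -big_filter; apply: (osc_cover _ _ K) => //.
  - exact: mB.
  - exact: fB.
  - by move=> i; exact: mB.
  - move=> i; rewrite mem_filter => /andP[_ is_]; apply: fB.
    by have := wrad_gt0 i (sdepth i is_); lra.
  - move=> y; rewrite /mball /= => x0y.
    have [|z zs zy] := cov y; first by lra.
    by exists z => //; rewrite mem_filter zs andbT; apply/asboolP; exists y.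
apply: (@le_trans _ _ (\sum_(i <- s | P i)
    \sum_(j <- s | j \in i :: ch i) K1 * (wgrad j * ballm i (wrad i)))).
  rewrite !(big_seq_cond P); apply: ler_sum => i /andP[is_ Pi].
  have [ut pt lt sub _] := chP i is_ Pi.
  have i0 := sdepth i is_.
  rewrite -mulr_sumr -mulr_suml.
  have -> : \sum_(j <- s | j \in i :: ch i) wgrad j = \sum_(j <- i :: ch i) wgrad j.
    rewrite -big_filter; apply: perm_big; apply: uniq_perm => //.
      exact: filter_uniq.
    move=> j; rewrite mem_filter; case: (boolP (j \in i :: ch i)) => //=.
    by move=> /sub ->.
  have dp : {in i :: ch i, forall v, 0 < depth v} by move=> v /sub; exact: sdepth.
  have := wavg_path i (ch i) dp pt; rewrite lt => e1.
  apply: le_trans (osc_whitney i (wavg x0) i0) _.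
  set S := \sum_(_ <- _) _ in e1 *.
  (* [i] lies on its own path, so [S] also absorbs the local term [2 * C0 * wgrad i]. *)
  have aS : wgrad i <= S.
    rewrite /S big_cons lerDl big_seq; apply: sumr_ge0 => j jt.
    by apply: wgrad_ge0; apply: dp; rewrite inE jt orbT.
  have -> : K1 * (S * ballm i (wrad i)) =
      Cg * ballm i (wrad i) * ((2 * C0 + 2 * (C0 * Cg)) * S) by rewrite /K1; ring.
  apply: ler_wpM2l; first by rewrite mulr_ge0 // ballm_ge0.
  rewrite [leRHS]mulrDl; apply: lerD => //; apply: ler_wpM2l => //.
  by rewrite mulr_ge0.
(* The shadow of [j], i.e. the [i] whose chain passes through [j], consists of
   centres of disjoint balls inside [B(j, 4 depth j)]. *)
rewrite (exchange_big_dep xpredT) //= [leRHS]mulr_sumr.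
rewrite !big_seq; apply: ler_sum => j js; have j0 := sdepth j js.
rewrite (eq_bigr (fun i => K1 * wgrad j * ballm i (wrad i))); last first.
  by move=> i _; rewrite mulrA.
rewrite -mulr_sumr.
have -> : K1 * Cg * (wgrad j * ballm j (wrad j)) =
  K1 * wgrad j * (Cg * ballm j (wrad j)) by ring.
apply: ler_wpM2l; first by rewrite mulr_ge0 ?wgrad_ge0.
apply: le_trans (ballm_depth j j0); rewrite -big_filter.
apply: ballm_packing => //; first by lra.
  move=> i; rewrite mem_filter => /andP[/andP[Pi ji] is_].
  have [_ _ _ _ G] := chP i is_ Pi.
  by split; [apply: wrad_gt0; exact: sdepth|exact: G].
exact: pairwise_filter.
Qed.

Let Om := mball dist x0 (L * r).
Let A := fine (\int[nu]_(y in Om) h y) / ballm x0 (L * r).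

(** With [A] the average of [h] over [Om], [powR_le_affine] splits the sum into the measures of
    disjoint balls and the masses [hmass] of dilated balls, whose overlap is at most [Cg]. *)
Lemma sum_wgrad (s : seq Y) :
  {in s, forall z, dist x0 z <= L * r'} ->
  pairwise (fun v w => wrad v + wrad w <= dist v w) s ->
  \sum_(j <- s) wgrad j * ballm j (wrad j) <=
    L * r * (1 + Cg) * ballm x0 (L * r) * A `^ p^-1.
Proof.
move=> sz sep.
have rm0 := net_depth_gt0; set rm := L * (r - r') in rm0.
have sdepth z : z \in s -> 0 < depth z.
  by move=> /sz hz; apply: lt_le_trans rm0 _; exact: depth_net.
have L0 : 0 < L by move: L1 => *; lra.
have Lr0 : 0 < L * r by rewrite mulr_gt0.
have m0 : 0 < ballm x0 (L * r) by exact: ballm_gt0.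
have mfS B : measurable_fun B h by exact: measurable_funS mh.
have lamV z : z \in s -> mball dist z (lam * (24 * wrad z)) `<=` Om.
  move=> zs; apply: mball_tri => //; have := lam_wrad_le z (sdepth z zs).
  by have := sdepth z zs; rewrite /depth; lra.
have H0 B : (0 <= \int[nu]_(y in B) h y)%E by apply: integral_ge0.
have HE z : z \in s ->
    (\int[nu]_(y in mball dist z (lam * (24 * wrad z))) h y = (hmass z)%:E)%E.
  move=> zs; rewrite /hmass fineK // ge0_fin_numE //; apply: le_lt_trans h_fin.
  by apply: ge0_subset_integral => //; [exact: mB|exact: mB|exact: lamV].
have HOm : (\int[nu]_(y in Om) h y = (A * ballm x0 (L * r))%:E)%E.
  by rewrite /A divfK ?gt_eqF // fineK // ge0_fin_numE.
have hm0 z : 0 <= hmass z by exact: fine_ge0.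
(* If the dilated ball at [v] contains [x], the depths of [v] and [x] are comparable. Then
   [B(v, wrad v)] lies in [B(x, 2 depth x)] and carries at least the fraction [1 / Cg] of its
   measure, so [size_packing] counts such [v]. *)
have sumH : \sum_(j <- s) hmass j <= Cg * (A * ballm x0 (L * r)).
  rewrite -lee_fin -sumEFin EFinM -HOm.
  rewrite (eq_big_seq (fun z => \int[nu]_(y in mball dist z (lam * (24 * wrad z))) h y))%E;
    last by move=> z zs; rewrite HE.
  apply: integral_overlap_le => //; [exact: mB|by move=> z; exact: mB|].
  move=> x; rewrite /Om /mball /= => Omx.
  have x0' : 0 < depth x by rewrite /depth; lra.
  rewrite -size_filter.
  apply: (size_packing dist nu dist_metric borel balls wrad _ x (2 * depth x)) => //.
  - by lra.
  - move=> v; rewrite mem_filter => /andP[/set_mem xv vs].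
    rewrite /mball /= in xv.
    have v0 := sdepth v vs; have lv := lam_wrad_le v v0; have wv := wrad_le v v0.
    have l1 := depth_lip v x; have l2 := depth_lip x v.
    rewrite (dsym x v) in l2 *.
    split; [exact: wrad_gt0|lra|].
    by apply: le_trans (ballm_depth v v0); apply: ballm_le => //; lra.
  - exact: pairwise_filter.
have sumD : \sum_(j <- s) ballm j (wrad j) <= ballm x0 (L * r).
  apply: ballm_packing => // v vs; have v0 := sdepth v vs; split.
    exact: wrad_gt0.
  by have := wrad_le v v0; have := wrad_gt0 v v0; rewrite /depth; lra.
have pV : 0 <= p^-1 by rewrite invr_ge0; move: p1 => *; lra.
have A0 : 0 <= A by rewrite divr_ge0 ?ballm_ge0 // fine_ge0.
have RHS0 : 0 <= L * r * (1 + Cg) * ballm x0 (L * r) * A `^ p^-1.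
  apply: mulr_ge0; last exact: powR_ge0.
  by rewrite !mulr_ge0 ?addr_ge0 // ltW.
(* The affine bound divides by [A]. For [A = 0] every [hmass j] vanishes, and with it [wgrad j],
   since [1 / p] is nonzero. *)
have [AE|Ane] := eqVneq A 0.
  apply: le_trans RHS0; rewrite big1_seq // => j /= js.
  have : hmass j <= 0.
    rewrite -lee_fin -HE //.
    have -> : 0%:E = (\int[nu]_(y in Om) h y)%E by rewrite HOm AE mul0r.
    by apply: ge0_subset_integral => //; [exact: mB|exact: mB|exact: lamV].
  move=> hj; have -> : wgrad j = 0; last by rewrite mul0r.
  have hj0 : hmass j = 0 by apply/eqP; rewrite eq_le hj hm0.
  rewrite /wgrad hj0 mul0r powR0 ?mulr0 //.
  by rewrite invr_eq0 gt_eqF //; move: p1 => *; lra.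
have Agt : 0 < A by rewrite lt_neqAle eq_sym Ane.
apply: (@le_trans _ _ (\sum_(j <- s)
    L * r * A `^ p^-1 * (ballm j (wrad j) + hmass j / A))).
  rewrite big_seq [leRHS]big_seq; apply: ler_sum => j js.
  have j0 := sdepth j js; have k0 := wrad_gt0 j j0.
  have b0 : 0 < ballm j (wrad j) by exact: ballm_gt0.
  have bV : ballm j (wrad j) <= ballm j (lam * (24 * wrad j)).
    apply: ballm_le => //; rewrite dist_xx //; have := lam_wrad_ge j j0; lra.
  (* The denominator is lowered to the measure of the small ball so that it cancels against the
     weight [ballm j (wrad j)]. *)
  have e1 : (hmass j / ballm j (lam * (24 * wrad j))) `^ p^-1 <=
            (hmass j / ballm j (wrad j)) `^ p^-1.
    apply: ge0_ler_powR => //; rewrite ?nnegrE ?divr_ge0 ?ballm_ge0 //.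
    by apply: ler_wpM2l => //; rewrite lef_pV2 ?posrE //; exact: lt_le_trans bV.
  have e2 := powR_le_affine p A (hmass j / ballm j (wrad j)) p1 Agt
    (divr_ge0 (hm0 j) (ltW b0)).
  rewrite /wgrad; apply: (@le_trans _ _ (L * r *
      (A `^ p^-1 * (1 + hmass j / ballm j (wrad j) / A)) * ballm j (wrad j))).
    apply: ler_wpM2r; first exact: ltW.
    apply: ler_pM; [exact: ltW|exact: powR_ge0|exact: depth_le|].
    exact: le_trans e1 e2.
  have -> : ballm j (wrad j) + hmass j / A =
      (1 + hmass j / ballm j (wrad j) / A) * ballm j (wrad j).
    by field; rewrite ?gt_eqF.
  by rewrite !mulrA.
rewrite -mulr_sumr big_split /= -mulr_suml.
have -> : L * r * (1 + Cg) * ballm x0 (L * r) * A `^ p^-1 =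
   L * r * A `^ p^-1 * (ballm x0 (L * r) + Cg * (A * ballm x0 (L * r)) / A).
  by field; rewrite ?gt_eqF.
apply: ler_wpM2l; first by rewrite mulr_ge0 ?powR_ge0 // ltW.
by apply: lerD => //; apply: ler_wpM2r => //; rewrite invr_ge0 ltW.
Qed.

End Net.

(** Combined, [osc_net] and [sum_wgrad] give a bound free of [r'] and of the net, so [r'] may
    increase to [r]. *)
Lemma osc_ball :
  osc nu u (mball dist x0 r) (wavg x0) <=
    Cg * (2 * C0 + 2 * (C0 * Cg)) * Cg * (L * r * (1 + Cg) * ballm x0 (L * r) *
    (fine (\int[nu]_(y in mball dist x0 (L * r)) h y) / ballm x0 (L * r)) `^ p^-1).
Proof.
(* The shift by 2 makes [rn 0] positive. *)
pose rn n : R := r - r / n.+2%:R.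
have rn0 n : 0 < rn n.
  by rewrite subr_gt0 ltr_pdivrMr // ltr_pMr // ltr1n.
have rnr n : rn n < r by rewrite ltrBlDr ltrDl divr_gt0.
apply: (osc_nondecreasing_le nu u K mu_u u_bd (fun n => mball dist x0 (rn n))).
- by move=> n; exact: mB.
- exact: mB.
- exact: fB.
- move=> n; apply: mball_le => //; rewrite lerD2l lerN2 ler_pM2l // lef_pV2 ?posrE //.
  by rewrite ler_nat.
- apply/seteqP; split => y; last first.
    by case=> n _; rewrite /mball /= => h'; exact: lt_trans (rnr n).
  rewrite /mball /= => x0y; have e0 : 0 < r - dist x0 y by lra.
  have q0 : 0 <= r / (r - dist x0 y) by rewrite divr_ge0 // ltW.
  exists (Num.bound (r / (r - dist x0 y))) => //=; rewrite /rn.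
  rewrite ltrBrDr addrC -ltrBrDr ltr_pdivrMr // mulrC -ltr_pdivrMr //.
  apply: lt_trans (archi_boundP q0) _; rewrite ltr_nat.
  by rewrite ltnS leqnSn.
move=> n; have [s [x0s sz sep cov]] := whitney_net (rn n) (rn0 n) (rnr n).
apply: le_trans (osc_net (rn n) (rn0 n) (rnr n) s x0s sz sep cov) _.
apply: ler_wpM2l; last exact: (sum_wgrad (rn n) (rnr n)).
by rewrite !mulr_ge0 // addr_ge0 // !mulr_ge0.
Qed.

End WhitneyChain.

(** * Diameter of a ball against its radius *)

Section Diameter.
Context {R : realType} {T : Type}.
Variable dist : T -> T -> R.
Hypothesis dist_metric : is_metric dist.

Lemma mdiam_ball_le x r : (mdiam dist (mball dist x r) <= (2 * r)%:E)%E.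
Proof.
apply: ge_ereal_sup => _ [y [z [xy [xz ->]]]]; rewrite lee_fin.
have := dist_tri _ dist_metric x y z; rewrite (dist_sym _ dist_metric y x).
by move: xy xz; rewrite /mball /=; lra.
Qed.

(** The Whitney estimate yields a factor [r] where the Poincare inequality has the diameter. A chain
    that starts at [x] and leaves [B(x, rho)] with steps below [rho / 2] cannot jump over the
    annulus between [rho / 2] and [rho]. *)
Lemma mdiam_ball_ge L M (a b : T) : quasiconvex dist L -> a <> b -> 0 < M ->
  exists2 kappa : R, 0 < kappa & forall x r, 0 < r -> r <= M ->
    (r%:E <= kappa%:E * mdiam dist (mball dist x r))%E.
Proof.
move=> qc ab M0; have del0 := dist_gt0 _ dist_metric a b ab.
(* [rho] is capped at [del / 2] so that [a] or [b] lies outside [B(x, rho)]. As [r <= M], this gives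
   [r <= (1 + 2 M / del) rho]; the factor 2 serves [rho / 2]. *)
set del := dist a b in del0; pose kappa := 2 * (1 + 2 * M / del).
have q0 : 0 < 2 * M / del by rewrite divr_gt0 ?mulr_gt0.
exists kappa; first by rewrite mulr_gt0 // addr_gt0.
move=> x r r0 rM; pose rho := Num.min r (del / 2).
have rho0 : 0 < rho by rewrite lt_min r0 divr_gt0.
have rhor : rho <= r by rewrite ge_min lexx.
have rhod : rho <= del / 2 by rewrite ge_min lexx orbT.
have rrho : r <= kappa * (rho / 2).
  have -> : kappa * (rho / 2) = rho + 2 * M / del * rho.
    by rewrite /kappa; field; rewrite gt_eqF.
  rewrite /rho minEle; case: ifP => _; first by rewrite lerDl mulr_ge0 // ltW.
  have -> : 2 * M / del * (del / 2) = M by field; rewrite gt_eqF.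
  by lra.
have [b' xb'] : exists b', rho <= dist x b'.
  have := dist_tri _ dist_metric x a b; rewrite (dist_sym _ dist_metric a x) => t.
  by have [h|h] := leP rho (dist x a); [exists a|exists b; rewrite -/del in t; lra].
have rho2 : 0 < rho / 2 by lra.
have [n [w [w0 wn step _]]] := quasiconvex_chain _ dist_metric L x b' (rho / 2) qc rho2.
have exk : exists k, rho / 2 <= dist x (w k) by exists n; rewrite wn; lra.
have kn : (ex_minn exk <= n)%N.
  by case: ex_minnP => k _; apply; rewrite wn; lra.
have [y ydist] : exists y, rho / 2 <= dist x y < rho.
  exists (w (ex_minn exk)); move: kn.
  case: ex_minnP => -[|k] hk mink kn.
    by move: hk; rewrite w0 dist_xx //; lra.
  rewrite hk /=; have := step k kn; have := dist_tri _ dist_metric (w k) x (w k.+1).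
  have : dist x (w k) < rho / 2.
    by rewrite ltNge; apply/negP => /mink; rewrite ltnn.
  by lra.
case/andP: ydist => h1 h2.
apply: (@le_trans _ _ (kappa%:E * (rho / 2)%:E)%E); first by rewrite -EFinM lee_fin.
apply: lee_wpmul2l; first by rewrite lee_fin mulr_ge0 // addr_ge0 // ltW.
apply: (@le_trans _ _ (dist x y)%:E); first by rewrite lee_fin.
apply: ereal_sup_ubound; exists x, y; split; first by rewrite /mball /= dist_xx.
by split => //; rewrite /mball /=; lra.
Qed.

End Diameter.

(** * Choice of constants and conclusion *)

Theorem theorem5p3 (R : realType) (d : measure_display) (Y : measurableType d)
    (dist : Y -> Y -> R) (nu : {measure set Y -> \bar R}) (p L R0 R1 : R) :
  1 <= p ->
  is_metric dist ->
  quasiconvex dist L ->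
  borel_sigma dist ->
  measure_is_complete nu ->
  (forall x r, 0 < r -> (0 < nu (mball dist x r))%E /\ (nu (mball dist x r) < +oo)%E) ->
  0 < R0 ->
  doubling_upto dist nu R0 ->
  (exists2 lam : R, 1 <= lam & poincare_upto dist nu p lam R0) ->
  0 < R1 ->
  poincare_upto dist nu p L R1.
Proof.
move=> p1 md qc borel _ balls R0p [Cd dbl] [lam lam1 [Cp pi]] R1p.
have mB := measurable_mball dist md borel.
have fB x r : 0 < r -> (nu (mball dist x r) < +oo)%E by move=> /(balls x)[].
have pB x r : 0 < r -> (0 < nu (mball dist x r))%E by move=> /(balls x)[].
have [[a [b ab]]|single] := pselect (exists a b : Y, a <> b); last first.
  (* With at most one point, [u] equals its average and the constant 0 works. The bounds [1 <= L]
     and [mdiam_ball_ge] below require two points. *)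
  exists 0 => x r r0 _ u g mu_u [K uK] _ /=; rewrite !mul0e.
  have eqx y : y = x by apply: contrapT => yx; apply: single; exists y, x.
  have osc0 : osc nu u (mball dist x r) (u x) = 0.
    rewrite /osc (eq_integral (cst 0%E)) ?integral_cst ?mul0e // => y _.
    by rewrite (eqx y) subrr normr0.
  have := osc_avg nu u K mu_u uK (mball dist x r) (u x) (mB x r) (fB x r r0) (pB x r r0).
  rewrite osc0 pmulr_rle0; last exact: (ballm_gt0 dist nu balls).
  rewrite normr_le0 subr_eq0 => /eqP ->.
  rewrite (eq_integral (cst 0%E)) ?integral_cst ?mul0e ?mule0 // => y _.
  by rewrite (eqx y) subrr normr0.
have L1 : 1 <= L by apply: (quasiconvex_ge1 dist md L a b).
have L0 : 0 < L by lra.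
have lam0 : 0 < lam by lra.
have LR1 : 0 < L * R1 by exact: mulr_gt0.
have [kappa kap0 diam_ge] := mdiam_ball_ge dist md L R1 a b qc ab R1p.
have Cd'0 : 0 <= Num.max Cd 0 by rewrite le_max lexx orbT.
have dbl' x r : 0 < r -> r <= R0 ->
    ballm dist nu x (2 * r) <= Num.max Cd 0 * ballm dist nu x r.
  move=> r0 rR; have [_ [h2 _]] := dbl x r r0 rR; move: h2.
  rewrite !(ballmE dist nu balls) ?mulr_gt0 // -EFinM lee_fin => h.
  apply: le_trans h _; apply: ler_wpM2r; first exact: (ballm_ge0 dist nu).
  by rewrite le_max lexx.
have gr := ballm_growth dist nu md borel balls L R0 _ qc R0p Cd'0 dbl'.
(* The three bounds on [c] keep dilated balls inside [Om], keep the Poincare radii [24 wrad z] at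
   most [R0], and make [c L r <= r], so that [B(x, L r)] is comparable in measure to [B(x, r)]. *)
pose c := Num.min (48 * lam)^-1 (Num.min (R0 / (24 * (L * R1))) L^-1).
have c0 : 0 < c.
  by rewrite !lt_min; apply/and3P; split; rewrite ?divr_gt0 ?invr_gt0 ?mulr_gt0.
have c1 : 48 * (c * lam) <= 1.
  by rewrite mulrCA -ler_pdivlMr ?mulr_gt0 // mul1r ge_min lexx.
have c2 : 24 * (c * (L * R1)) <= R0.
  rewrite mulrCA -ler_pdivlMr ?mulr_gt0 //.
  by rewrite !ge_min lexx orbT.
have c3 : c * L <= 1 by rewrite -ler_pdivlMr // mul1r !ge_min lexx !orbT.
have [Cg Cg0 CgP] : exists2 Cg, 0 <= Cg & forall z s, 0 < s -> s <= L * R1 ->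
    ballm dist nu z (4 * s) <= Cg * ballm dist nu z (c * s).
  have k0 : 0 < 4 / c by rewrite divr_gt0.
  have [C C0 CP] := gr (4 / c) (c * (L * R1)) k0; exists C => // z s s0 sL.
  have -> : 4 * s = 4 / c * (c * s) by field; rewrite gt_eqF.
  by apply: CP; rewrite ?mulr_gt0 ?ler_pM2l.
pose K2 := Cg * (2 * `|Cp| + 2 * (`|Cp| * Cg)) * Cg.
have K20 : 0 <= K2 by rewrite !mulr_ge0 // addr_ge0 // !mulr_ge0.
(* The factor 2 pays for returning to the average over [B(x, r)], and the final [Cg] compares
   [B(x, L r)] with [B(x, r)]. The summand 1 makes [K3] positive, so that the right side is infinite
   when the integral of [h] is. *)
pose K3 := 2 * K2 * (L * (1 + Cg) * Cg) + 1.
have K30 : 0 < K3.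
  apply: ltr_wpDl => //; apply: mulr_ge0; first exact: mulr_ge0.
  by apply: mulr_ge0 => //; apply: mulr_ge0; [exact: ltW|exact: addr_ge0].
exists (K3 * kappa) => x r r0 rR1 u g mu_u [K uK] ug /=.
set Om := mball dist x (L * r).
have Lr0 : 0 < L * r by exact: mulr_gt0.
have LrR : L * r <= L * R1 by rewrite ler_pM2l.
have mOm0 : 0 < ballm dist nu x (L * r) by exact: ballm_gt0.
have mB0 : 0 < ballm dist nu x r by exact: ballm_gt0.
have pV : 0 < p^-1 by rewrite invr_gt0; lra.
pose h y := poweR (g y) p.
have h0 y : (0 <= h y)%E by exact: poweR_ge0.
have mg : measurable_fun setT g.
  by move=> _ B mBB; rewrite setTI; apply: borel; case: ug => + _ _; apply.
have mh : measurable_fun setT h.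
  exact: (measurableT_comp (measurable_poweR p) mg).
have H0 B : (0 <= \int[nu]_(y in B) h y)%E by apply: integral_ge0.
rewrite -/(ballm dist nu x r) -/(ballm dist nu x (L * r)).
have dr := diam_ge x r r0 rR1.
set D := mdiam dist _ in dr *.
have KD : ((K3 * r)%:E <= (K3 * kappa)%:E * D)%E.
  by rewrite !EFinM -muleA lee_wpmul2l // lee_fin ltW.
have [hfin|] := ltP (\int[nu]_(y in Om) h y)%E +oo%E; last first.
  rewrite leye_eq => /eqP hinf; rewrite -/Om hinf gt0_muley ?lte_fin ?invr_gt0 //.
  rewrite poweRyr ?gt_eqF // gt0_muley ?leey //.
  by apply: lt_le_trans KD; rewrite lte_fin mulr_gt0.
pose A := fine (\int[nu]_(y in Om) h y) / ballm dist nu x (L * r).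
have AE : ((ballm dist nu x (L * r))^-1%:E * \int[nu]_(y in Om) h y = A%:E)%E.
  by rewrite /A EFinM muleC fineK // ge0_fin_numE.
rewrite -/Om AE poweR_EFin.
(* The assumed inequality on [V], multiplied by the measure of [V]. The diameter of [V] is at most
   [48 wrad z <= depth z], hence the factor [depth] in [wgrad]. *)
have poin z : 0 < depth dist L r x z ->
    let V := mball dist z (24 * wrad dist L c r x z) in
    osc nu u V (mavg nu V u) <= `|Cp| * ballm dist nu z (24 * wrad dist L c r x z) *
      wgrad dist nu L lam c p r x h z.
  move=> z0; have k0 := wrad_gt0 dist L c r x c0 z z0; cbv zeta.
  set rV := 24 * wrad dist L c r x z; set V := mball dist z rV.
  have rV0 : 0 < rV by rewrite mulr_gt0.
  have rVR : rV <= R0.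
    apply: le_trans c2; rewrite ler_pM2l // ler_pM2l //.
    by apply: le_trans LrR; exact: depth_le.
  have lrV0 : 0 < lam * rV by exact: mulr_gt0.
  have b0 : 0 < ballm dist nu z rV by exact: ballm_gt0.
  have := pi z rV rV0 rVR u g mu_u (ex_intro _ K uK) ug => /=.
  rewrite -/V -/(ballm dist nu z rV) -/(ballm dist nu z (lam * rV)).
  rewrite (oscE nu u K mu_u uK V _ (mB _ _) (fB _ _ rV0)) -EFinM.
  have -> : (\int[nu]_(y in mball dist z (lam * rV)) (g y `^ p) =
      (hmass dist nu L lam c r x h z)%:E)%E.
    rewrite /hmass fineK // ge0_fin_numE //; apply: le_lt_trans hfin.
    apply: ge0_subset_integral => //; first exact: mB.
      exact: measurable_funS mh.
    apply: mball_tri => //.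
    have := lam_wrad_le dist L lam c r x c1 z z0; rewrite -/rV.
    by move: z0; rewrite /depth; lra.
  rewrite -EFinM poweR_EFin => piz.
  have -> : wgrad dist nu L lam c p r x h z = depth dist L r x z *
      ((ballm dist nu z (lam * rV))^-1 * hmass dist nu L lam c r x h z) `^ p^-1.
    by rewrite /wgrad (mulrC _^-1).
  set Q := (_ * hmass _ _ _ _ _ _ _ _ _) `^ _ in piz *.
  have Q0 : 0 <= Q by exact: powR_ge0.
  have -> : `|Cp| * ballm dist nu z rV * (depth dist L r x z * Q) =
    ballm dist nu z rV * (`|Cp| * depth dist L r x z * Q) by ring.
  rewrite -ler_pdivrMl // -lee_fin; apply: le_trans piz _.
  rewrite [leRHS]EFinM; apply: lee_wpmul2r; first by rewrite lee_fin.
  rewrite EFinM.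
  have D0 : (0 <= mdiam dist V)%E.
    apply: ereal_sup_ubound; exists z, z; rewrite /V /mball /= dist_xx //.
  apply: (@le_trans _ _ (`|Cp|%:E * mdiam dist V)%E).
    by apply: lee_wpmul2r => //; rewrite lee_fin ler_norm.
  apply: lee_wpmul2l; first by rewrite lee_fin.
  apply: le_trans (mdiam_ball_le dist md z rV) _; rewrite lee_fin.
  by have := wrad_le dist L lam c r x lam1 c0 c1 z z0; rewrite /rV; lra.
have CgP' z s : 0 < s -> s <= L * r ->
    ballm dist nu z (4 * s) <= Cg * ballm dist nu z (c * s).
  by move=> s0 sL; apply: CgP => //; exact: le_trans LrR.
have gr' kap : 0 < kap -> exists2 C, 0 <= C & forall z s, 0 < s -> s <= L * r ->
    ballm dist nu z (kap * s) <= C * ballm dist nu z s.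
  by move=> k0; exact: (gr kap (L * r) k0).
have main := osc_ball dist nu md borel balls L lam c p Cg `|Cp| r K x u h qc L1 lam1
   c0 c1 p1 Cg0 (normr_ge0 _) r0 mu_u uK mh h0 hfin CgP' gr' poin.
rewrite -/Om -/A -/K2 in main.
rewrite (oscE nu u K mu_u uK _ _ (mB _ _) (fB _ _ r0)) -EFinM.
set B := mball dist x r in main *; set u0 := wavg _ _ _ _ _ _ _ _ in main.
have e1 := osc_tri nu u K mu_u uK B (mavg nu B u) u0 (mB _ _) (fB _ _ r0).
have e2 := osc_avg nu u K mu_u uK B u0 (mB _ _) (fB _ _ r0) (pB _ _ r0).
rewrite distrC in e2.
have Ap0 : 0 <= A `^ p^-1 by exact: powR_ge0.
have mOmB : ballm dist nu x (L * r) <= Cg * ballm dist nu x r.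
  apply: (@le_trans _ _ (ballm dist nu x (4 * (L * r)))).
    by apply: ballm_le => //; rewrite dist_xx //; lra.
  apply: le_trans (CgP' _ _ Lr0 (lexx _)) _; apply: ler_wpM2l => //.
  apply: ballm_le => //; first by rewrite mulr_gt0.
  by rewrite dist_xx // add0r mulrA ger_pMl.
apply: (@le_trans _ _ ((K3 * r)%:E * (A `^ p^-1)%:E)%E); last first.
  by apply: lee_wpmul2r => //; rewrite lee_fin.
rewrite -EFinM lee_fin mulrC ler_pdivrMr //.
apply: (@le_trans _ _ (2 * (K2 * (L * r * (1 + Cg) * (Cg * ballm dist nu x r) * A `^ p^-1)))).
  apply: (@le_trans _ _ (2 * osc nu u B u0)); first by lra.
  rewrite ler_pM2l //; apply: le_trans main _; apply: ler_wpM2l => //.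
  apply: ler_wpM2r => //; apply: ler_wpM2l => //.
  by rewrite !mulr_ge0 ?addr_ge0 // ltW.
rewrite /K3.
have -> : (2 * K2 * (L * (1 + Cg) * Cg) + 1) * r * A `^ p^-1 * ballm dist nu x r =
  2 * (K2 * (L * r * (1 + Cg) * (Cg * ballm dist nu x r) * A `^ p^-1)) +
  r * A `^ p^-1 * ballm dist nu x r by ring.
by rewrite lerDl !mulr_ge0 // ltW.
Qed.
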